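(* Let $d,N\in\mathbb{N}$ with $d,N\ge 1$, let $X=\{x^1,\ldots,x^N\}\subseteq\mathbb{R}^d$, and let $p\in(0,1)$ be such that $pN\notin\mathbb{Z}$. Let $e=(1,\ldots,1)^{\mathsf T}\in\mathbb{R}^d$, let $\ell(x)=\binom{x}{-e^{\mathsf T}x}\in\mathbb{R}^{d+1}$ for $x\in\mathbb{R}^d$, and let $\ell(X)=\{\ell(x^1),\ldots,\ell(x^N)\}\subseteq\mathbb{R}^{d+1}$ be the lifted data set. Let $C=\mathbb{R}^{d+1}_+$ and let $c\in\operatorname{int}C$. For $w\in\mathbb{R}^{d+1}$ set $\lambda(w)=(w_1-w_{d+1},\ldots,w_d-w_{d+1})^{\mathsf T}\in\mathbb{R}^d$. Then the vector linear program $$\min\nolimits_K\ D(w,t)\quad\text{s.t. } (w,t)\in B^+\times\mathbb{R}$$ (defined from $\ell(X),p,C,c$ as in the context) has a solution $\bar T$ (a finite set, in the sense defined in the context) which provides the following finite representation of the Tukey depth region: $$Q^-_{X,\{0\}}(p)=\bigcap_{(w,t)\in\bar T}\{z\in\mathbb{R}^d \mid \lambda(w)^{\mathsf T}z\ge t\}.$$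
   Context: Positive and negative parts: $y^+=\max\{0,y\}$, $y^-=\max\{0,-y\}$ for $y\in\mathbb{R}$. For $y\in\mathbb{R}$, $\lceil y\rceil$ is the smallest integer not smaller than $y$. Scalar quantile: for real data $a^1,\ldots,a^N$ (counted with multiplicity), the empirical lower quantile is $$q^-_{(a^1,\ldots,a^N)}(p)=\min\{a\in\{a^1,\ldots,a^N\} \mid \#\{i\in\{1,\ldots,N\} \mid a^i\le a\}\ge\lceil Np\rceil\}.$$ For $X=\{x^1,\ldots,x^N\}\subseteq\mathbb{R}^d$ and $w\in\mathbb{R}^d$, write $q^-_{w^{\mathsf T}X}(p)$ for the empirical lower quantile of the data $w^{\mathsf T}x^1,\ldots,w^{\mathsf T}x^N$. Tukey depth region (cone quantile for the cone $\{0\}$, whose positive dual cone is $\mathbb{R}^d$): $$Q^-_{X,\{0\}}(p)=\bigcap_{w\in\mathbb{R}^d\setminus\{0\}}\{z\in\mathbb{R}^d \mid w^{\mathsf T}z\ge q^-_{w^{\mathsf T}X}(p)\}.$$ Vector linear program for the lifted data: $B^+=\{w\in\mathbb{R}^{d+1}_+ \mid w^{\mathsf T}c=1\}$. For $w\in\mathbb{R}^{d+1}$ and $t\in\mathbb{R}$ let $$\phi_{w^{\mathsf T}\ell(X),p}(t)=\sum_{i=1}^N\left[p\,(w^{\mathsf T}\ell(x^i)-t)^+ +(1-p)\,(w^{\mathsf T}\ell(x^i)-t)^-\right]+(1-p)\sum_{i=1}^N w^{\mathsf T}\ell(x^i),$$ and let $$D(w,t)=\left(w_1,\ \ldots,\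 w_d,\ \phi_{w^{\mathsf T}\ell(X),p}(t)\right)^{\mathsf T}\in\mathbb{R}^{d+1}.$$ The order cone is $K=\{y\in\mathbb{R}^{d+1} \mid y_1=\cdots=y_d=0,\ y_{d+1}\ge 0\}$, with order $y^1\le_K y^2$ if and only if $y^2-y^1\in K$. The feasible set is $T=B^+\times\mathbb{R}$ and $D[T]=\{D(w,t) \mid (w,t)\in T\}$. A point $\bar y\in D[T]$ is $K$-minimal if $y\in D[T]$ and $y\le_K\bar y$ imply $y=\bar y$; a feasible point $(w,t)\in T$ is a $K$-minimizer if $D(w,t)$ is $K$-minimal in $D[T]$. A solution to the problem is a finite set $\bar T\subseteq T$ of $K$-minimizers such that $$D[T]+K=\operatorname{conv}D[\bar T]+K,$$ where $\operatorname{conv}$ denotes the convex hull. *)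

(* Defs.v *)
From HB Require Import structures.
From mathcomp Require Import all_boot all_order all_algebra archimedean.
From mathcomp Require Import boolp classical_sets cardinality reals topology normedtype.
From mathcomp Require Import convex.

Set Implicit Arguments.
Unset Strict Implicit.
Unset Printing Implicit Defensive.

Import Order.TTheory GRing.Theory Num.Theory.
Import numFieldNormedType.Exports.

Local Open Scope classical_set_scope.
Local Open Scope ring_scope.

Section Definitions.
Context {R : realType}.

Definition dot n (u v : 'cV[R]_n) : R := \sum_(i < n) u i 0 * v i 0.

Definition posp (y : R) : R := Num.max 0 y.
Definition negp (y : R) : R := Num.max 0 (- y).

Definition minkowski_sum n (A B : set 'cV[R]_n) : set 'cV[R]_n :=
  [set z | exists a b, [/\ A a, B b & z = a + b]].

Definition conv_hull n (A : set 'cV[R]_n) : set 'cV[R]_n :=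
  smallest (@convex_set R 'cV[R]_n) A.

Definition orthant n : set 'cV[R]_n := [set w | forall i, 0 <= w i 0].

(* The minimum of a set of reals, with junk value 0 if there is none. *)
Definition set_min (A : set R) : R := xget 0 (A `&` lbound A).

(* Candidate values of the lower quantile. The data form a family, so the
   cardinal counts indices, i.e. data with multiplicity. *)
Definition quantile_set N (a : 'I_N -> R) (p : R) : set R :=
  [set y | range a y /\
     (Num.ceil (N%:R * p) <= (#|[set i | a i <= y]%SET| : int))%R].

Definition lower_quantile N (a : 'I_N -> R) (p : R) : R :=
  set_min (quantile_set a p).

(* The minimum exists, so the junk value plays no role. *)
Lemma lower_quantile_min N (a : 'I_N -> R) (p : R) :
  (0 < N)%N -> p <= 1 ->
  quantile_set a p (lower_quantile a p) /\
  lbound (quantile_set a p) (lower_quantile a p).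
Proof.
case: N a => // N a _ p1.
pose P i := (Num.ceil (N.+1%:R * p) <=
  (#|[set j | (a j <= a i)%R]%SET| : int))%R.
have [m _ mmax] := @arg_maxP _ R 'I_N.+1 ord0 predT a isT.
have Pm : P m.
  rewrite /P.
  have -> : [set j | a j <= a m]%SET = [set: 'I_N.+1]%SET.
    by apply/finset.setP => j; rewrite !finset.inE; exact: mmax.
  rewrite cardsT card_ord.
  rewrite ceil_le_int -pmulrn -[leRHS]mulr1.
  exact: ler_wpM2l.
have [i Pi imin] := @arg_minP _ R 'I_N.+1 m P a Pm.
rewrite /lower_quantile /set_min.
apply: (@xgetPex _ 0 (quantile_set a p `&` lbound (quantile_set a p))).
exists (a i); split; first by split; [exists i|].
by move=> _ [[j _ <-]] Pj; exact: imin.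
Qed.

(* Cone quantile for the cone {0}. *)
Definition tukey_region d N (x : 'I_N -> 'cV[R]_d) (p : R) : set 'cV[R]_d :=
  \bigcap_(w in [set w : 'cV[R]_d | w != 0])
    [set z | lower_quantile (fun i => dot w (x i)) p <= dot w z].

Definition lift_pt d (x : 'cV[R]_d) : 'cV[R]_(d + 1) :=
  col_mx x (- (dot (const_mx 1) x))%:M.

Definition lambda d (w : 'cV[R]_(d + 1)) : 'cV[R]_d :=
  \col_(i < d) (w (lshift 1 i) 0 - w (rshift d ord0) 0).

Definition phi N (a : 'I_N -> R) (p t : R) : R :=
  \sum_(i < N) (p * posp (a i - t) + (1 - p) * negp (a i - t))
  + (1 - p) * \sum_(i < N) a i.

Definition Bplus n (c : 'cV[R]_n) : set 'cV[R]_n :=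
  [set w | orthant w /\ dot w c = 1].

(* D(w,t), for data y in R^(d+1) (y will be the lifted data). *)
Definition objective d N (y : 'I_N -> 'cV[R]_(d + 1)) (p : R)
    (wt : 'cV[R]_(d + 1) * R) : 'cV[R]_(d + 1) :=
  col_mx (usubmx wt.1) (phi (fun i => dot wt.1 (y i)) p wt.2)%:M.

Definition order_cone d : set 'cV[R]_(d + 1) :=
  [set y | (forall i : 'I_d, y (lshift 1 i) 0 = 0) /\ 0 <= y (rshift d ord0) 0].

(* Vector linear program: minimise F over S with respect to the order
   y1 <=_K y2 iff K (y2 - y1). *)
Definition is_Kminimal n (K A : set 'cV[R]_n) (ybar : 'cV[R]_n) : Prop :=
  A ybar /\ forall y, A y -> K (ybar - y) -> y = ybar.

Definition is_Kminimizer n (U : Type) (K : set 'cV[R]_n) (F : U -> 'cV[R]_n)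
    (S : set U) (u : U) : Prop :=
  S u /\ is_Kminimal K (F @` S) (F u).

Definition is_solution n (U : Type) (K : set 'cV[R]_n)
    (F : U -> 'cV[R]_n) (S Sbar : set U) : Prop :=
  [/\ finite_set Sbar,
      Sbar `<=` is_Kminimizer K F S &
      minkowski_sum (F @` S) K = minkowski_sum (conv_hull (F @` Sbar)) K].

End Definitions.

Arguments orthant {R} n.
Arguments order_cone {R} d.

(* Main.v *)
Require Import Defs.
From HB Require Import structures.
From mathcomp Require Import all_boot all_order all_algebra archimedean.
From mathcomp Require Import boolp classical_sets cardinality reals topology normedtype.
From mathcomp Require Import convex.
From mathcomp Require Import interval_inference ring lra.

Set Implicit Arguments.
Unset Strict Implicit.
Unset Printing Implicit Defensive.

Import Order.TTheory GRing.Theory Num.Theory.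
Import numFieldNormedType.Exports.

Local Open Scope classical_set_scope.
Local Open Scope ring_scope.

(** Write [y i] for the lifted data. Since [dot w (lift_pt z)] equals
[dot (lambda w) z] and [lambda] maps the orthant onto R^d, the Tukey region is
cut out by the inequalities [quant w <= dot w (lift_pt z)], [w] in the orthant.

The hyperplanes [dot w (y j - y k) = 0] divide the orthant into finitely many
closed polyhedral cones on which the order of the numbers [dot w (y i)] is constant
in the weak sense. On each of them the lower quantile is attained at one fixed
index ([quant_linear_on_cell]), hence is linear in [w], and so is the minimum
of [phi] over [t] ([phi_linear_on_cell]), which is attained at the quantile
([phi_lower_quantile_le], a subgradient estimate). A finite set [V] generates
all these cones at once ([finite_cell_generators]): every [w] in the orthant
is a conic combination of elements of [V] which lie in the cone of [w].

The solution consists of the nonzero elements [w] of [V] in the orthant,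
normalized so that [dot w c = 1], each paired with its quantile. A feasible point whose [t] is
its quantile is a K-minimizer ([quant_Kminimizer]), because [dot w c = 1]
recovers the last coordinate of [w] from the others. By linearity on cells, the
point of the graph of the minimum above any feasible [w] is a convex
combination of objective values of the solution
([objective_quant_conv_hull]); since the upper image is convex
([upper_image_convex]), this gives the equality demanded of a solution. By the
same linearity, the inequality [quant w <= dot w (lift_pt z)] for an arbitrary
[w] is a nonnegative combination of those for the elements of [V], so that the
finitely many half-spaces suffice. *)

(** * Linearity of the dot product *)

Section DotProduct.
Context {R : realType} {n : nat}.
Implicit Types (u v w : 'cV[R]_n) (s : R).

Lemma dotDl v w u : dot (v + w) u = dot v u + dot w u.
Proof. by rewrite -big_split; apply: eq_bigr => i _; rewrite mxE mulrDl. Qed.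

Lemma dotZl s v u : dot (s *: v) u = s * dot v u.
Proof. by rewrite /dot mulr_sumr; apply: eq_bigr => i _; rewrite mxE mulrA. Qed.

Lemma dot0l u : dot 0 u = 0.
Proof. by rewrite -(scale0r u) dotZl mul0r. Qed.

Lemma dotC v u : dot v u = dot u v.
Proof. by apply: eq_bigr => i _; rewrite mulrC. Qed.

Lemma dotDr v w u : dot u (v + w) = dot u v + dot u w.
Proof. by rewrite dotC dotDl !(dotC u). Qed.

Lemma dotZr s v u : dot u (s *: v) = s * dot u v.
Proof. by rewrite dotC dotZl (dotC u). Qed.

Lemma dotBr v w u : dot u (v - w) = dot u v - dot u w.
Proof. by rewrite -scaleN1r dotDr dotZr mulN1r. Qed.

Lemma dot_sumr (I : finType) (F : I -> 'cV[R]_n) u :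
  dot u (\sum_i F i) = \sum_i dot u (F i).
Proof.
by apply: (big_morph (dot u)) => [v w|]; rewrite ?dotDr // dotC dot0l.
Qed.

End DotProduct.

(** * Conic hulls and cells of a hyperplane arrangement *)

Section ConicHulls.
Context {R : realType} {n : nat}.
Implicit Types (A B : set 'cV[R]_n) (u v w h : 'cV[R]_n).

(** The closure rules, rather than explicit finite combinations, make every
property stable under addition and nonnegative scaling provable by induction. *)
Inductive cone_hull A : set 'cV[R]_n :=
| cone_gen v of A v : cone_hull A v
| cone0 : cone_hull A 0
| coneD v w of cone_hull A v & cone_hull A w : cone_hull A (v + w)
| coneZ (s : R) v of 0 <= s & cone_hull A v : cone_hull A (s *: v).

Lemma cone_hullS A B : A `<=` B -> cone_hull A `<=` cone_hull B.
Proof.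
move=> AB w; elim=> [v /AB|||s v]; [exact: cone_gen|exact: cone0|..].
- by move=> v1 v2 _ ? _ ?; exact: coneD.
- by move=> ? _ ?; exact: coneZ.
Qed.

Lemma cone_comb A (s t : R) v w : 0 <= s -> 0 <= t ->
  cone_hull A v -> cone_hull A w -> cone_hull A (s *: v + t *: w).
Proof. by move=> *; apply: coneD; apply: coneZ. Qed.

Lemma cone_hull_dot_ge0 A u :
  (forall v, A v -> 0 <= dot v u) -> forall w, cone_hull A w -> 0 <= dot w u.
Proof.
move=> Au w; elim=> [v /Au //||v1 v2 _ h1 _ h2|s v s0 _ h].
- by rewrite dot0l.
- by rewrite dotDl addr_ge0.
- by rewrite dotZl mulr_ge0.
Qed.

(** If [dot w u <= 0 <= dot v u], this is a nonnegative multiple of the point where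
the segment from [v] to [w] crosses the hyperplane orthogonal to [u]. *)
Definition crossing u v w : 'cV[R]_n := dot v u *: w - dot w u *: v.

Lemma dot_crossing u v w : dot (crossing u v w) u = 0.
Proof. by rewrite /crossing -scaleNr dotDl !dotZl mulNr mulrC subrr. Qed.

Definition cut A u : set 'cV[R]_n :=
  [set v | A v /\ 0 <= dot v u] `|`
  [set v | exists a b, [/\ A a, A b, 0 <= dot a u, dot b u <= 0 &
                           v = crossing u a b]].

(** This is the step of the double description method. The part of the cone of
[A] with [dot w u <= 0] needs its own induction hypothesis, since such points
occur as summands: all their crossings with points [h] of the cut cone lie in
that cone. *)
Lemma cone_hull_cut A u w :
  cone_hull A w -> 0 <= dot w u -> cone_hull (cut A u) w.
Proof.
pose H := cone_hull (cut A u).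
have Hge0 h : H h -> 0 <= dot h u.
  apply: cone_hull_dot_ge0 => v [[]//|[a [b [_ _ _ _ ->]]]].
  by rewrite dot_crossing.
suff S : cone_hull A w -> (0 <= dot w u -> H w) /\
    (dot w u <= 0 -> forall h, H h -> H (crossing u h w)).
  by move=> /S[].
elim=> {w} [a Aa|||s w s0 _ [Hw Cw]].
- split=> [ua|ua h]; first by apply: cone_gen; left.
  elim=> {h} [h [[Ah uh]|[b [b' [Ab Ab' ub ub' ->]]]]||h k _ Hh _ Hk|s h s0 _ Hh].
  + by apply: cone_gen; right; exists h, a.
  + rewrite /crossing dot_crossing scale0r add0r -scaleNr.
    by apply: coneZ; [rewrite oppr_ge0|apply: cone_gen; right; exists b, b'].
  + by rewrite /crossing dot0l scale0r scaler0 subrr; exact: cone0.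
  + have -> : crossing u (h + k) a = crossing u h a + crossing u k a.
      by apply/colP => i; rewrite /crossing dotDl !mxE; ring.
    exact: coneD.
  + have -> : crossing u (s *: h) a = s *: crossing u h a.
      by apply/colP => i; rewrite /crossing dotZl !mxE; ring.
    exact: coneZ.
- split=> [_|_ h _]; first exact: cone0.
  by rewrite /crossing dot0l scale0r scaler0 subrr; exact: cone0.
  (* A sum of two points on opposite sides of the hyperplane. *)
- have mixed v w : H v -> 0 < dot v u -> dot w u < 0 ->
      (forall h, H h -> H (crossing u h w)) ->
      (0 <= dot (v + w) u -> H (v + w)) /\
      (dot (v + w) u <= 0 -> forall h, H h -> H (crossing u h (v + w))).
    rewrite dotDl => Hv v0 w0 Cw; split=> [vw0|vw0 h Hh].
      have -> : v + w =
          ((dot v u + dot w u) / dot v u) *: v + (dot v u)^-1 *: crossing u v w.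
        by apply/colP => i; rewrite /crossing !mxE; field; rewrite gt_eqF.
      apply: cone_comb => //; last exact: Cw.
      - by rewrite divr_ge0 // ltW.
      - by rewrite invr_ge0 ltW.
    have -> : crossing u h (v + w) =
        (dot h u / - dot w u) *: crossing u v w +
        ((dot v u + dot w u) / dot w u) *: crossing u h w.
      apply/colP => i; rewrite /crossing dotDl !mxE; field.
      by rewrite lt_eqF.
    apply: cone_comb; [| |exact: Cw|exact: Cw].
    - by rewrite divr_ge0 ?Hge0 // oppr_ge0 ltW.
    - by rewrite -mulrNN mulr_ge0 ?oppr_ge0 // invr_le0 ltW.
  move=> v w _ [Hv Cv] _ [Hw Cw].
  have crossD h : crossing u h (v + w) = crossing u h v + crossing u h w.
    by apply/colP => i; rewrite /crossing dotDl !mxE; ring.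
  have [v0|v0] := lerP 0 (dot v u); have [w0|w0] := lerP 0 (dot w u).
  + split=> [_|]; first by apply: coneD; [exact: Hv|exact: Hw].
    by rewrite dotDl => s0 h Hh; rewrite crossD; apply: coneD;
       [apply: Cv|apply: Cw] => //; lra.
  + move: v0; rewrite le_eqVlt => /orP[/eqP v0|v0]; last first.
      by apply: mixed => //; [exact/Hv/ltW|exact/Cw/ltW].
    rewrite dotDl -v0 add0r; split=> [|s0 h Hh]; first by rewrite leNgt w0.
    by rewrite crossD; apply: coneD; [apply: Cv; rewrite -?v0|exact: Cw].
  + move: w0; rewrite le_eqVlt => /orP[/eqP w0|w0]; last first.
      by rewrite addrC; apply: mixed => //; [exact/Hw/ltW|exact/Cv/ltW].
    rewrite dotDl -w0 addr0; split=> [|s0 h Hh]; first by rewrite leNgt v0.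
    by rewrite crossD; apply: coneD; [exact: Cv|apply: Cw; rewrite -?w0].
  + rewrite dotDl; split=> [s0|_ h Hh]; first by exfalso; lra.
    by rewrite crossD; apply: coneD; [apply: Cv|apply: Cw] => //; exact: ltW.
- rewrite dotZl; move: s0; rewrite le_eqVlt => /orP[/eqP<-|s0].
    rewrite scale0r mul0r; split=> [_|_ h _]; first exact: cone0.
    by rewrite /crossing dot0l scale0r scaler0 subrr; exact: cone0.
  rewrite pmulr_rge0 // pmulr_rle0 //.
  split=> [/Hw|w0 h Hh]; first exact: coneZ (ltW s0).
  have -> : crossing u h (s *: w) = s *: crossing u h w.
    by apply/colP => i; rewrite /crossing dotZl !mxE; ring.
  by apply: coneZ; [exact: ltW|exact: Cw].
Qed.

(** For [us] closed under opposite, this is the smallest closed face containing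
[w] of the arrangement of hyperplanes orthogonal to the elements of [us],
within the orthant. *)
Definition cell (us : seq 'cV[R]_n) w : set 'cV[R]_n :=
  [set v | orthant n v /\
    forall u, u \in us -> 0 <= dot w u -> 0 <= dot v u].

Lemma cell_crossing us w u a b : 0 <= dot a u -> dot b u <= 0 ->
  cell us w a -> cell us w b -> cell us w (crossing u a b).
Proof.
move=> a0 b0 [oa ca] [ob cb]; rewrite /crossing -scaleNr; split=> [i|u' u'us w0].
  by rewrite !mxE addr_ge0 // mulr_ge0 ?oppr_ge0.
by rewrite dotDl !dotZl addr_ge0 // mulr_ge0 ?oppr_ge0 //; [exact: cb|exact: ca].
Qed.

Lemma orthant_cone_hull w :
  orthant n w -> cone_hull ((fun i => delta_mx i 0) @` [set: 'I_n]) w.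
Proof.
move=> w0; have -> : w = \sum_i w i 0 *: delta_mx i 0.
  rewrite [LHS]matrix_sum_delta; apply: eq_bigr => i _.
  by rewrite big_ord1.
apply: big_ind => [|v1 v2|i _]; [exact: cone0|exact: coneD|].
by apply: coneZ; [exact: w0|apply: cone_gen; exists i].
Qed.

(** The list of hyperplanes is treated one at a time: to the generators obtained
so far are added all their pairwise crossings with the new hyperplane. Some of
these leave the orthant, but only those in the cell of [w] are ever used. *)
Lemma finite_cell_generators (us : seq 'cV[R]_n) :
  exists2 V, finite_set V &
    forall w, orthant n w -> cone_hull (V `&` cell us w) w.
Proof.
elim: us => [|u us [V Vfin VP]].
  exists ((fun i => delta_mx i 0) @` [set: 'I_n]).
    by apply: finite_image; exact: finite_finset.
  move=> w /orthant_cone_hull; apply: cone_hullS => v Vv; split=> //; split=> //.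
  by case: Vv => i _ <- j; rewrite mxE ler0n.
exists (V `|` [set crossing u a b | a in V & b in V]).
  by rewrite finite_setU; split=> //; exact: finite_image2.
move=> w w0; have hw := VP w w0.
have [uw|uw] := lerP 0 (dot w u); last first.
  apply: cone_hullS hw => v [Vv [v0 cv]]; split; [by left|split=> // u'].
  by rewrite inE => /orP[/eqP->|]; [rewrite leNgt uw|exact: cv].
apply: cone_hullS (cone_hull_cut hw uw) => v [[[Vv [v0 cv]] uv]|].
  split; [by left|split=> // u'].
  by rewrite inE => /orP[/eqP->|]; [|exact: cv].
move=> [a [b [[Va ca] [Vb cb] ua ub ->]]]; split.
  by right; exists a => //; exists b.
have [o c] := cell_crossing ua ub ca cb; split=> // u'.
by rewrite inE => /orP[/eqP->|]; [rewrite dot_crossing|exact: c].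
Qed.

End ConicHulls.

(** * Convex hulls *)

Section ConvexHulls.
Context {R : realType} {n : nat}.
Implicit Types (A : set 'cV[R]_n) (a b : 'cV[R]_n) (s t : R).

Lemma convex_setP A : @convex_set R 'cV[R]_n A <->
  forall a b s t, 0 <= s -> 0 <= t -> s + t = 1 -> A a -> A b ->
    A (s *: a + t *: b).
Proof.
split=> [Acvx a b s t s0 t0 st Aa Ab|Acvx a b l].
  have s1 : s <= 1 by rewrite -st lerDl.
  have /= := Acvx a b (Itv01 s0 s1) (mem_set Aa) (mem_set Ab).
  by have -> : t = 1 - s by [rewrite -st addrC addKr]; move/set_mem.
move=> /set_mem Aa /set_mem Ab; apply: mem_set.
by apply: Acvx => //; rewrite ?subr_ge0 // addrC subrK.
Qed.

Lemma conv_hull_gen A : A `<=` conv_hull A.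
Proof. exact: sub_gen_smallest. Qed.

Lemma conv_hull_comb A a b s t : 0 <= s -> 0 <= t -> s + t = 1 ->
  conv_hull A a -> conv_hull A b -> conv_hull A (s *: a + t *: b).
Proof.
move=> s0 t0 st Aa Ab B [Bcvx AB].
by apply: (convex_setP B).1 => //; [apply: Aa|apply: Ab].
Qed.

End ConvexHulls.

(** * The lower quantile as a minimizer of the pinball loss *)

Section LowerQuantiles.
Context {R : realType} {N : nat}.
Implicit Types (a b : 'I_N -> R) (p q t : R).

(** The second count restates minimality without comparing data values, so that it
depends only on the order of the data. *)
Lemma lower_quantileP a p : (0 < N)%N -> 0 < p <= 1 ->
  exists i, [/\ lower_quantile a p = a i,
    N%:R * p <= #|[set j | a j <= a i]%SET|%:R &
    #|[set j | a j < a i]%SET|%:R < N%:R * p].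
Proof.
move=> N0 /andP[p0 p1].
have [[[i _ qi] qle] qmin] := lower_quantile_min a N0 p1.
exists i; rewrite -qi; split=> //.
  by move: qle; rewrite -qi ceil_le_int.
rewrite ltNge; apply/negP => le_lt.
have /card_gt0P[k] : (0 < #|[set j | (a j < a i)%R]%SET|)%N.
  by rewrite -(ltr_nat R); apply: lt_le_trans le_lt; rewrite mulr_gt0 // ltr0n.
rewrite finset.inE => ki.
(* The largest datum below q would be a smaller candidate for the quantile. *)
have [m mi mmax] := @arg_maxP _ R 'I_N k [pred j | a j < a i] a ki.
have : a i <= a m.
  rewrite qi; apply: qmin; split; first by exists m.
  rewrite ceil_le_int; apply: le_trans le_lt _; rewrite ler_nat.
  by apply/subset_leq_card/fintype.subsetP => j; rewrite !finset.inE => /mmax.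
by rewrite leNgt (mi : a m < a i).
Qed.

Lemma lower_quantile_eq a p i : p <= 1 ->
  N%:R * p <= #|[set j | a j <= a i]%SET|%:R ->
  #|[set j | a j < a i]%SET|%:R < N%:R * p ->
  lower_quantile a p = a i.
Proof.
move=> p1 le_i lt_i; have N0 : (0 < N)%N := leq_ltn_trans (leq0n i) (ltn_ord i).
have [[[k _ qk] qle] qmin] := lower_quantile_min a N0 p1.
apply/le_anti; rewrite qmin /=; last by split; [exists i|rewrite ceil_le_int].
rewrite leNgt; apply/negP => lt_q.
move: qle; rewrite ceil_le_int leNgt => /negP; apply.
apply: le_lt_trans lt_i; rewrite ler_nat.
by apply/subset_leq_card/fintype.subsetP => j; rewrite !finset.inE => /le_lt_trans; apply.
Qed.

Lemma pinball_ge0 p (y : R) : 0 <= y -> p * posp y + (1 - p) * negp y = p * y.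
Proof.
by move=> y0; rewrite /posp /negp max_r // max_l ?oppr_le0 // mulr0 addr0.
Qed.

Lemma pinball_le0 p (y : R) :
  y <= 0 -> p * posp y + (1 - p) * negp y = (1 - p) * - y.
Proof.
by move=> y0; rewrite /posp /negp max_l // max_r ?oppr_ge0 // mulr0 add0r.
Qed.

(** The slope of the loss in [t] to the right of [q] is at least its right
derivative at [q], which is [1 - p] or [- p]. *)
Lemma pinball_le_right p (y q t : R) : q <= t ->
  p * posp (y - q) + (1 - p) * negp (y - q) + (t - q) * ((y <= q)%R%:R - p) <=
  p * posp (y - t) + (1 - p) * negp (y - t).
Proof.
move=> qt; have [yq|qy] := leP y q.
  by rewrite !pinball_le0 ?subr_le0 ?(le_trans yq) //=; lra.
rewrite (@pinball_ge0 _ (y - q)) ?subr_ge0 ?(ltW qy) //; have [yt|ty] := leP y t.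
  by rewrite pinball_le0 ?subr_le0 //=; lra.
by rewrite pinball_ge0 ?subr_ge0 ?(ltW ty) //=; lra.
Qed.

(** The mirror image of the previous bound, with the left derivative at [q]. *)
Lemma pinball_le_left p (y q t : R) : t <= q ->
  p * posp (y - q) + (1 - p) * negp (y - q) + (q - t) * (p - (y < q)%R%:R) <=
  p * posp (y - t) + (1 - p) * negp (y - t).
Proof.
move=> tq; have [qy|yq] := leP q y.
  by rewrite !pinball_ge0 ?subr_ge0 ?(le_trans tq) //=; lra.
rewrite (@pinball_le0 _ (y - q)) ?subr_le0 ?(ltW yq) //; have [ty|yt] := leP t y.
  by rewrite pinball_ge0 ?subr_ge0 //=; lra.
by rewrite pinball_le0 ?subr_le0 ?(ltW yt) //=; lra.
Qed.

Lemma sum_pred (P : pred 'I_N) : \sum_i (P i)%:R = #|[set i | P i]%SET|%:R :> R.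
Proof.
rewrite -natr_sum; congr _%:R; rewrite -sum1_card big_mkcond /=.
by rewrite [RHS]big_mkcond; apply: eq_bigr => i _; rewrite finset.inE; case: (P i).
Qed.

(** Summing the one-sided derivatives at the quantile [q] gives the number of data
at most [q], minus [N p], to the right, and [N p] minus the number of data
below [q] to the left: both are nonnegative. *)
Lemma phi_lower_quantile_le a p t : (0 < N)%N -> 0 < p < 1 ->
  phi a p (lower_quantile a p) <= phi a p t.
Proof.
move=> N0 p01; have /andP[p0 p1] := p01.
have p01' : 0 < p <= 1 by rewrite p0 ltW.
have [i [-> le_i lt_i]] := lower_quantileP a N0 p01'.
rewrite /phi lerD2r; set q := a i in le_i lt_i *.
have [qt|/ltW tq] := leP q t.
- apply: le_trans (ler_sum _ (fun j _ => pinball_le_right p (a j) qt)).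
  rewrite [leRHS]big_split /= lerDl -mulr_sumr big_split /= sum_pred sumr_const.
  by rewrite card_ord mulNrn -[p *+ N]mulr_natl mulr_ge0 // subr_ge0.
- apply: le_trans (ler_sum _ (fun j _ => pinball_le_left p (a j) tq)).
  rewrite [leRHS]big_split /= lerDl -mulr_sumr big_split /= sumrN sum_pred sumr_const.
  by rewrite card_ord -[p *+ N]mulr_natl mulr_ge0 // subr_ge0 // ltW.
Qed.


(** Joint convexity in the data and [t]: [phi] is a sum of positively homogeneous
subadditive functions of the numbers [a i - t] and a linear function of [a]. *)
Lemma phi_convex p (s t : R) a b (ta tb : R) : 0 < p < 1 -> 0 <= s -> 0 <= t ->
  phi (fun i => s * a i + t * b i) p (s * ta + t * tb) <=
  s * phi a p ta + t * phi b p tb.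
Proof.
move=> /andP[p0 p1] s0 t0.
have max_comb x y : Num.max 0 (s * x + t * y) <= s * Num.max 0 x + t * Num.max 0 y.
  rewrite ge_max addr_ge0 ?mulr_ge0 ?le_max ?lexx //=.
  by rewrite lerD // ler_wpM2l // le_max lexx orbT.
rewrite /phi.
have -> : \sum_i (s * a i + t * b i) = s * \sum_i a i + t * \sum_i b i.
  by rewrite big_split /= !mulr_sumr.
set Sa := \sum_i (_ + _ * negp (a i - ta)).
set Sb := \sum_i (_ + _ * negp (b i - tb)).
have -> : s * (Sa + (1 - p) * \sum_i a i) + t * (Sb + (1 - p) * \sum_i b i) =
  s * Sa + t * Sb + (1 - p) * (s * \sum_i a i + t * \sum_i b i) by ring.
rewrite lerD2r /Sa /Sb.
rewrite !mulr_sumr -big_split /=; apply: ler_sum => i _.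
have -> : s * a i + t * b i - (s * ta + t * tb) =
  s * (a i - ta) + t * (b i - tb) by ring.
have -> : s * (p * posp (a i - ta) + (1 - p) * negp (a i - ta)) +
    t * (p * posp (b i - tb) + (1 - p) * negp (b i - tb)) =
  p * (s * posp (a i - ta) + t * posp (b i - tb)) +
  (1 - p) * (s * negp (a i - ta) + t * negp (b i - tb)) by ring.
apply: lerD.
  by apply: ler_wpM2l; [exact: ltW|exact: max_comb].
apply: ler_wpM2l; first by rewrite subr_ge0 ltW.
by rewrite /negp opprD -!mulrN; exact: max_comb.
Qed.

End LowerQuantiles.

(** * Linearity of quantiles on cells *)

Section QuantileOnCells.
Context {R : realType} {n N : nat} (y : 'I_N -> 'cV[R]_n) (p : R).
Context (N0 : (0 < N)%N) (p01 : 0 < p < 1).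
Implicit Types (v w : 'cV[R]_n).

Definition quant w := lower_quantile (fun i => dot w (y i)) p.

Definition differences : seq 'cV[R]_n :=
  [seq y jk.1 - y jk.2 | jk <- enum {: 'I_N * 'I_N}].

Lemma cell_le v w j k : cell differences w v ->
  dot w (y k) <= dot w (y j) -> dot v (y k) <= dot v (y j).
Proof.
move=> [_ /(_ (y j - y k))]; rewrite !dotBr !subr_ge0; apply.
by apply/mapP; exists (j, k); rewrite ?mem_enum.
Qed.

Lemma cellD us w v1 v2 :
  cell us w v1 -> cell us w v2 -> cell us w (v1 + v2).
Proof.
move=> [o1 c1] [o2 c2]; split=> [i|u us_u w0]; first by rewrite mxE addr_ge0.
by rewrite dotDl addr_ge0 ?c1 ?c2.
Qed.

Lemma cellZ us w (s : R) v : 0 <= s -> cell us w v -> cell us w (s *: v).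
Proof.
move=> s0 [o c]; split=> [i|u us_u w0]; first by rewrite mxE mulr_ge0.
by rewrite dotZl mulr_ge0 ?c.
Qed.

(** Passing from [w] to a point [v] of its cell can turn strict inequalities
between the data into equalities but reverses none. So the count of data at
most the [i]-th one can only grow, the count of data below it can only shrink,
and an index of the quantile at [w] stays one at [v]. *)
Lemma quant_linear_on_cell w :
  exists i, forall v, cell differences w v -> quant v = dot v (y i).
Proof.
have /andP[p0 p1] := p01; have p01' : 0 < p <= 1 by rewrite p0 ltW.
have [i [_ le_i lt_i]] := lower_quantileP (fun i => dot w (y i)) N0 p01'.
exists i => v cv; apply: lower_quantile_eq; first exact: ltW.
- apply: (le_trans le_i); rewrite ler_nat.
  apply/subset_leq_card/fintype.subsetP => j; rewrite !finset.inE.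
  exact: cell_le.
- apply: le_lt_trans lt_i; rewrite ler_nat.
  apply/subset_leq_card/fintype.subsetP => j; rewrite !finset.inE !ltNge.
  by apply: contra; exact: cell_le.
Qed.

(** On a cell, each difference between a datum and the quantile keeps a weak sign,
so its loss is the same linear branch throughout. *)
Lemma phi_linear_on_cell w :
  exists u, forall v, cell differences w v ->
    phi (fun i => dot v (y i)) p (quant v) = dot v u.
Proof.
have [i iP] := quant_linear_on_cell w.
exists (\sum_j (if dot w (y i) <= dot w (y j) then p *: (y j - y i)
                else (1 - p) *: (y i - y j)) + (1 - p) *: \sum_j y j) => v cv.
rewrite iP // /phi dotDr dotZr !dot_sumr; congr (_ + _).
apply: eq_bigr => j _; case: ifPn => [wij|]; rewrite ?dotZr ?dotBr.
  by rewrite pinball_ge0 // subr_ge0; exact: cell_le wij.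
rewrite -ltNge => /ltW wji.
by rewrite pinball_le0 ?opprB // subr_le0; exact: cell_le wji.
Qed.

End QuantileOnCells.

(** * The lifting *)

Section Lifting.
Context {R : realType} {d : nat}.
Implicit Types (z : 'cV[R]_d) (v w c : 'cV[R]_(d + 1)).

Lemma dot_split v w : dot v w =
  \sum_(i < d) v (lshift 1 i) 0 * w (lshift 1 i) 0 +
  v (rshift d ord0) 0 * w (rshift d ord0) 0.
Proof. by rewrite /dot big_split_ord big_ord1. Qed.

Lemma dot_lift_pt w z : dot w (lift_pt z) = dot (lambda w) z.
Proof.
rewrite dot_split col_mxEd [(_%:M) _ _]mxE eqxx mulr1n mulrN.
rewrite {1 2}/dot mulr_sumr -sumrN -big_split; apply: eq_bigr => i _ /=.
by rewrite col_mxEu !mxE mul1r mulrBl.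
Qed.

Lemma lambda_orthant_surj z : exists2 w, orthant (d + 1) w & lambda w = z.
Proof.
(* Adding the constant m to z makes it nonnegative; lambda removes it again. *)
pose m : R := \sum_i `|z i 0|.
have m0 : 0 <= m by apply: sumr_ge0.
exists (col_mx (z + const_mx m) m%:M) => [i|]; last first.
  by apply/colP => i; rewrite mxE col_mxEu col_mxEd !mxE eqxx mulr1n addrK.
case: (split_ordP i) => j ->; last by rewrite col_mxEd mxE ord1 eqxx.
rewrite col_mxEu !mxE -lerBlDl sub0r; apply: le_trans (_ : `|z j 0| <= _).
  by rewrite -normrN ler_norm.
by rewrite /m (bigD1 j) //= lerDl sumr_ge0.
Qed.

Lemma interior_orthant_gt0 n (c : 'cV[R]_n) :
  interior (orthant n) c -> forall i, 0 < c i 0.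
Proof.
move=> /nbhs_ballP[e e0 ce] i.
have : orthant n (c - const_mx (e / 2)).
  apply: ce; split=> // j k; rewrite !mxE /ball /= opprB addrC subrK.
  by rewrite ger0_norm ?divr_ge0 ?ltW // ltr_pdivrMr // ltr_pMr // ltr1n.
move=> /(_ i); rewrite !mxE subr_ge0; apply: lt_le_trans.
by rewrite divr_gt0.
Qed.

Lemma dot_gt0 n (v c : 'cV[R]_n) : (forall i, 0 < c i 0) ->
  orthant n v -> v != 0 -> 0 < dot v c.
Proof.
move=> c0 v0 vn0; rewrite lt_neqAle eq_sym sumr_ge0 ?andbT; last first.
  by move=> i _; rewrite mulr_ge0 // ltW.
apply: contra vn0; rewrite psumr_eq0 => [/allP vc0|i _]; last first.
  by rewrite mulr_ge0 // ltW.
apply/eqP/colP => i; rewrite mxE.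
have := vc0 i (mem_index_enum i); rewrite /= mulf_eq0 (gt_eqF (c0 i)) orbF.
by move/eqP.
Qed.

End Lifting.

(** * The vector linear program *)

Section LinearProgram.
Context {R : realType} {d N : nat}.
Context (y : 'I_N -> 'cV[R]_(d + 1)) (p : R) (c : 'cV[R]_(d + 1)).
Context (N0 : (0 < N)%N) (p01 : 0 < p < 1) (c0 : forall i, 0 < c i 0).
Implicit Types (v w u : 'cV[R]_(d + 1)).

Local Notation feasible := (Bplus c `*` [set: R]).
Local Notation K := (@order_cone R d).

(** The objective is of this form, with the value of [phi] as [s]; here [s] is
free, so that the expression is jointly linear in [w] and [s]. *)
Definition with_height w (s : R) : 'cV[R]_(d + 1) := col_mx (usubmx w) s%:M.

Lemma with_height_comb (s t hv hw : R) v w :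
  with_height (s *: v + t *: w) (s * hv + t * hw) =
  s *: with_height v hv + t *: with_height w hw.
Proof.
by rewrite /with_height !scale_col_mx add_col_mx !linearP /= !linearZ /=
  !scale_scalar_mx raddfD.
Qed.

Lemma order_cone_with_height w (s t : R) :
  K (with_height w t - with_height w s) <-> s <= t.
Proof.
rewrite /order_cone /with_height opp_col_mx add_col_mx subrr; split=> [[_]|st].
  by rewrite col_mxEd !mxE eqxx !mulr1n subr_ge0.
by split=> [i|]; [rewrite col_mxEu mxE|rewrite col_mxEd !mxE eqxx !mulr1n subr_ge0].
Qed.

Lemma order_coneD a b : K a -> K b -> K (a + b).
Proof.
move=> [a0 a1] [b0 b1]; split=> [i|]; rewrite mxE ?addr_ge0 //.
by rewrite a0 b0 addr0.
Qed.

Lemma order_coneZ (s : R) a : 0 <= s -> K a -> K (s *: a).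
Proof.
move=> s0 [a0 a1]; split=> [i|]; rewrite mxE ?mulr_ge0 //.
by rewrite a0 mulr0.
Qed.

(** The equation [dot w c = 1] determines the last coordinate, since [c] is
positive. *)
Lemma feasible_usubmx_inj v w :
  Bplus c v -> Bplus c w -> usubmx v = usubmx w -> v = w.
Proof.
move=> [_ vc] [_ wc] /colP vw.
have vwE i : v (lshift 1 i) 0 = w (lshift 1 i) 0.
  by have := vw i; rewrite !mxE.
have : dot v c = dot w c by rewrite vc.
rewrite !dot_split (eq_bigr (fun i => w (lshift 1 i) 0 * c (lshift 1 i) 0));
  last by move=> i _; rewrite vwE.
move=> /addrI /mulIf vwd; apply/colP => i.
case: (split_ordP i) => j ->; rewrite ?vwE // ord1 vwd //.
by rewrite gt_eqF.
Qed.

Lemma quant_Kminimizer w : Bplus c w ->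
  is_Kminimizer K (objective y p) feasible (w, quant y p w).
Proof.
move=> Bw; split; first by split.
split; first by exists (w, quant y p w).
move=> _ [[v t] [/= Bv _] <-] le_w.
have vw : v = w.
  apply: feasible_usubmx_inj => //; apply/colP => i.
  have [/(_ i) + _] := le_w.
  rewrite mxE [X in _ + X]mxE /objective !col_mxEu => /eqP.
  by rewrite subr_eq0 => /eqP.
subst v; rewrite /objective /=; congr (col_mx _ _%:M); apply/le_anti.
rewrite phi_lower_quantile_le // andbT.
exact/(order_cone_with_height w).
Qed.

Lemma upper_image_convex :
  @convex_set R 'cV[R]_(d + 1) (minkowski_sum (objective y p @` feasible) K).
Proof.
apply/convex_setP => _ _ s t s0 t0 st [_ [k [[[v tv] [/= [v0 vc] _] <-] Kk ->]]]
  [_ [l [[[w tw] [/= [w0 wc] _] <-] Kl ->]]].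
have Bvw : Bplus c (s *: v + t *: w).
  split=> [i|]; first by rewrite !mxE addr_ge0 ?mulr_ge0.
  by rewrite dotDl !dotZl vc wc !mulr1.
pose h := s * phi (fun i => dot v (y i)) p tv + t * phi (fun i => dot w (y i)) p tw.
pose g := phi (fun i => dot (s *: v + t *: w) (y i)) p (s * tv + t * tw).
exists (with_height (s *: v + t *: w) g),
  (with_height (s *: v + t *: w) h - with_height (s *: v + t *: w) g +
   (s *: k + t *: l)); split.
- by exists (s *: v + t *: w, s * tv + t * tw).
- apply: order_coneD; last by apply: order_coneD; exact: order_coneZ.
  apply/order_cone_with_height; apply: le_trans (phi_convex _ _ _ _ p01 s0 t0).
  rewrite /g (_ : (fun i => _) = (fun i => s * dot v (y i) + t * dot w (y i))) //.
  by apply/funext => i; rewrite dotDl !dotZl.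
- by rewrite addrA [_ + (_ - _)]addrC subrK with_height_comb !scalerDr addrACA.
Qed.

Definition normalize w := (dot w c)^-1 *: w.

Lemma normalize_feasible w : orthant (d + 1) w -> w != 0 -> Bplus c (normalize w).
Proof.
move=> w0 wn0; have wc := dot_gt0 c0 w0 wn0; split=> [i|].
  by rewrite mxE mulr_ge0 // invr_ge0 ltW.
by rewrite dotZl mulVf // gt_eqF.
Qed.

Definition quantile_point w := (normalize w, quant y p (normalize w)).

(** On the cell of [w], the normalized objective at the quantile is [with_height v
(dot v u)] divided by [dot v c], with a fixed [u]. The points of the cell where
this lies in the convex hull, together with 0, form a convex cone: scaling
changes nothing, and the value at [v1 + v2] averages the values at [v1] and
[v2] with weights proportional to [dot v1 c] and [dot v2 c]. *)
Lemma objective_quant_conv_hull (S : set 'cV[R]_(d + 1)) w :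
  cone_hull (S `&` cell (differences y) w) w -> Bplus c w ->
  conv_hull (objective y p @`
      (quantile_point @` (S `&` [set v | orthant (d + 1) v /\ v != 0])))
    (objective y p (w, quant y p w)).
Proof.
set D := conv_hull _ => hw [w0 wc].
have [u uP] := phi_linear_on_cell y N0 p01 w.
have wn0 : w != 0.
  by apply: contra_eqN wc => /eqP ->; rewrite dot0l eq_sym oner_eq0.
have cw : cell (differences y) w w by split.
suff /(_ w hw)[_ [wE|]] : forall v, cone_hull (S `&` cell (differences y) w) v ->
    cell (differences y) w v /\ (v = 0 \/ D ((dot v c)^-1 *: with_height v (dot v u))).
- by rewrite wE eqxx in wn0.
- by rewrite wc invr1 scale1r -uP.
move=> v; elim=> {v} [v [Sv cv]||v1 v2 _ [cv1 h1] _ [cv2 h2]|s v s0 _ [cv h]].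
- split=> //; have [->|vn0] := eqVneq v 0; [by left|right].
  apply: conv_hull_gen; exists (quantile_point v).
    by exists v => //; split=> //; case: cv.
  have vc : 0 <= (dot v c)^-1 by rewrite invr_ge0 ltW // dot_gt0 //; case: cv.
  rewrite /quantile_point /objective /= uP; last exact: cellZ.
  rewrite dotZl -/(with_height _ _).
  have := with_height_comb (dot v c)^-1 0 (dot v u) 0 v 0.
  by rewrite mul0r !scale0r !addr0.
- split; last by left.
  by split=> [i|u' _ _]; rewrite ?mxE ?dot0l.
- split; first exact: cellD.
  have [->|v10] := eqVneq v1 0; first by rewrite add0r.
  have [->|v20] := eqVneq v2 0; first by rewrite addr0.
  case: h1 => [/eqP|h1]; first by rewrite (negPf v10).
  case: h2 => [/eqP|h2]; first by rewrite (negPf v20).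
  right; have c1 := dot_gt0 c0 cv1.1 v10; have c2 := dot_gt0 c0 cv2.1 v20.
  have c12 : 0 < dot v1 c + dot v2 c by rewrite addr_gt0.
  rewrite !dotDl.
  have -> : with_height (v1 + v2) (dot v1 u + dot v2 u) =
      with_height v1 (dot v1 u) + with_height v2 (dot v2 u).
    by have := with_height_comb 1 1 (dot v1 u) (dot v2 u) v1 v2;
       rewrite !mul1r !scale1r.
  have -> : forall a b, (dot v1 c + dot v2 c)^-1 *: (a + b) =
      (dot v1 c / (dot v1 c + dot v2 c)) *: ((dot v1 c)^-1 *: a) +
      (dot v2 c / (dot v1 c + dot v2 c)) *: ((dot v2 c)^-1 *: b) :> 'cV[R]_(d + 1).
    move=> a b; apply/colP => i; rewrite !mxE; field.
    by rewrite !gt_eqF.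
  apply: conv_hull_comb => //.
  + by rewrite divr_ge0 // ltW.
  + by rewrite divr_ge0 // ltW.
  + by rewrite -mulrDl divff // gt_eqF.
- split; first exact: cellZ.
  move: s0; rewrite le_eqVlt => /orP[/eqP <-|s0]; first by left; rewrite scale0r.
  case: h => [->|h]; [by left; rewrite scaler0|right].
  rewrite !dotZl.
  have := with_height_comb s 0 (dot v u) 0 v 0.
  rewrite mul0r !scale0r !addr0 => ->.
  by rewrite scalerA invfM mulrAC mulVf ?mul1r // gt_eqF.
Qed.

Lemma solution_quantile_points (S : set 'cV[R]_(d + 1)) :
  finite_set S ->
  (forall w, orthant (d + 1) w -> cone_hull (S `&` cell (differences y) w) w) ->
  is_solution K (objective y p) feasible
    (quantile_point @` (S `&` [set v | orthant (d + 1) v /\ v != 0])).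
Proof.
move=> Sfin Sgen; split.
- by apply: finite_image; apply: sub_finite_set Sfin => v [].
- by move=> _ [v [_ [v0 vn0]] <-]; exact/quant_Kminimizer/normalize_feasible.
apply/seteqP; split=> [_ [_ [k [[[w t] [/= Bw _] <-] Kk ->]]]|].
  exists (objective y p (w, quant y p w)).
  exists (objective y p (w, t) - objective y p (w, quant y p w) + k); split.
  - by apply: objective_quant_conv_hull => //; apply: Sgen; case: Bw.
  - apply: order_coneD => //; apply/(order_cone_with_height w).
    exact: phi_lower_quantile_le.
  - by rewrite addrA [_ + (_ - _)]addrC subrK.
move=> _ [a [k [Da Kk ->]]].
have [b [l [Db Kl ->]]] : minkowski_sum (objective y p @` feasible) K a.
  apply: Da; split; first exact: upper_image_convex.
  move=> _ [_ [v [_ [v0 vn0]] <-] <-].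
  exists (objective y p (quantile_point v)), 0; split; last by rewrite addr0.
    by exists (quantile_point v) => //; split=> //; exact: normalize_feasible.
  by split=> [i|]; rewrite mxE.
by exists b, (l + k); split=> //; [exact: order_coneD|rewrite addrA].
Qed.

End LinearProgram.

(** * The Tukey depth region *)

Lemma lower_quantile_cst {R : realType} N (p : R) :
  (0 < N)%N -> 0 < p <= 1 -> lower_quantile (fun _ : 'I_N => 0) p = 0.
Proof. by move=> N0 p01; have [i []] := lower_quantileP (fun=> 0) N0 p01. Qed.

Theorem mainTheorem2 (R : realType) (d N : nat) (x : 'I_N -> 'cV[R]_d) (p : R)
    (c : 'cV[R]_(d + 1)) :
  (1 <= d)%N -> (1 <= N)%N ->
  0 < p < 1 -> p * N%:R \isn't a Num.int ->
  interior (orthant (d + 1)) c ->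
  exists Tbar : set ('cV[R]_(d + 1) * R)%type,
    is_solution (order_cone d) (objective (fun i => lift_pt (x i)) p)
      (Bplus c `*` [set: R]) Tbar /\
    tukey_region x p =
      \bigcap_(wt in Tbar) [set z : 'cV[R]_d | wt.2 <= dot (lambda wt.1) z].
Proof.
move=> _ N0 p01 _ /interior_orthant_gt0 c0.
have /andP[p0 p1] := p01; have p01' : 0 < p <= 1 by rewrite p0 ltW.
pose y i := lift_pt (x i).
have quantE w : quant y p w = lower_quantile (fun i => dot (lambda w) (x i)) p.
  by congr lower_quantile; apply/funext => i; exact: dot_lift_pt.
have [V Vfin Vgen] := finite_cell_generators (differences y).
exists (quantile_point y p c @` (V `&` [set v | orthant (d + 1) v /\ v != 0])).
split; first exact: solution_quantile_points.
apply/seteqP; split=> z.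
  move=> zP _ [v [_ [v0 vn0]] <-] /=; set w := normalize c v.
  (* For lambda w = 0 all data vanish and the inequality reads 0 <= 0. *)
  rewrite quantE; have [->|wn0] := eqVneq (lambda w) 0; last exact: zP.
  rewrite dot0l (_ : (fun i => _) = fun=> 0) ?lower_quantile_cst //.
  by apply/funext => i; rewrite dot0l.
move=> zP v _ /=; have [w w0 <-] := lambda_orthant_surj v.
rewrite -quantE -dot_lift_pt.
have cw : cell (differences y) w w by split.
have [i iP] := quant_linear_on_cell y N0 p01 w.
(* The inequality is linear on the cell of w, so it passes from the generators
   in that cell to w. *)
rewrite iP // -subr_ge0 -dotBr.
apply: cone_hull_dot_ge0 (Vgen w w0) => u [Vu cu].
have [->|un0] := eqVneq u 0; first by rewrite dot0l.
have uc := dot_gt0 c0 cu.1 un0.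
have /= := zP (quantile_point y p c u).
rewrite -dot_lift_pt iP; last by apply: cellZ => //; rewrite invr_ge0 ltW.
rewrite -subr_ge0 -dotBr dotZl pmulr_rge0 ?invr_gt0 //; apply.
by exists u => //; split=> //; split=> //; case: cu.
Qed.
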